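(* There exists a configuration $(2,4)$ $GDD(15,2,6;15,16)$.
   Context: A $GDD(n,2,6;\lambda_1,\lambda_2)$ is a finite collection (repetitions allowed) of $6$-element subsets, called blocks, of a $2n$-element set $X$ partitioned into two groups of size $n$, such that every point lies in the same number $r$ of blocks, any two distinct points of the same group lie together in exactly $\lambda_1$ blocks, and any two points from different groups lie together in exactly $\lambda_2$ blocks. It has configuration $(2,4)$ if every block has exactly $2$ points in one of the two groups and $4$ points in the other (which group contains the $2$ points may depend on the block). *)

(* Defs.v *)
From mathcomp Require Import all_boot.

Set Implicit Arguments.
Unset Strict Implicit.
Unset Printing Implicit Defensive.

(* GDD(n, m, k; l1, l2) on the point set X. A collection of blocks in which
   repetitions are allowed is a sequence B, so that [count] counts blocks with
   multiplicity. P is the set of groups. *)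
Record is_GDD (X : finType) (n m k l1 l2 : nat)
    (P : {set {set X}}) (B : seq {set X}) : Prop := IsGDD {
  GDD_partition : partition P [set: X];
  GDD_num_groups : #|P| = m;
  GDD_group_size : forall G : {set X}, G \in P -> #|G| = n;
  GDD_block_size : forall b : {set X}, b \in B -> #|b| = k;
  GDD_replication :
    exists r : nat, forall x : X, count (fun b : {set X} => x \in b) B = r;
  GDD_same_group : forall (G : {set X}) (x y : X),
    G \in P -> x \in G -> y \in G -> x != y ->
    count (fun b : {set X} => (x \in b) && (y \in b)) B = l1;
  GDD_diff_groups : forall (G H : {set X}) (x y : X),
    G \in P -> H \in P -> G != H -> x \in G -> y \in H ->
    count (fun b : {set X} => (x \in b) && (y \in b)) B = l2
}.

(* Intended for two groups, so that H is the group other than G; which of the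
   two is met in s points may depend on the block. *)
Definition has_configuration (X : finType) (s t : nat)
    (P : {set {set X}}) (B : seq {set X}) : Prop :=
  forall b : {set X}, b \in B ->
  exists G H : {set X},
    [/\ G \in P, H \in P, G != H, #|b :&: G| = s & #|b :&: H| = t].

(* Main.v *)
(** Take Z_30 as point set, with the even and the odd residues as groups.
    Develop 15 base blocks (five blocks with multiplicities 3, 5, 2, 2, 3)
    through all translations of Z_30.  The number of blocks through [x] and [y]
    is then the number of times [y - x] occurs as a difference in the base
    blocks, and these are chosen so that every nonzero even difference occurs
    15 times and every odd one 16 times. *)
Require Import Defs.
From mathcomp Require Import all_boot.
From mathcomp Require Import ssralg finalg zmodp.

Set Implicit Arguments.
Unset Strict Implicit.
Unset Printing Implicit Defensive.

Import GRing.Theory.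
Local Open Scope ring_scope.

Definition translate (V : finZmodType) (D : seq V) (t : V) : {set V} :=
  [set x | x - t \in D].

Definition develop (V : finZmodType) (Ds : seq (seq V)) : seq {set V} :=
  [seq translate D t | D <- Ds, t <- enum V].

Definition difference_count (V : finZmodType) (Ds : seq (seq V)) (d : V) : nat :=
  sumn [seq count (fun s => s + d \in D) D | D <- Ds].

(** Translation by [t] is injective, and as [D] has no repeated entries, counting along it is taking
    a cardinality. *)
Lemma card_translate (V : finZmodType) (D : seq V) (t : V) (P : pred V) :
  uniq D ->
  #|[set x in translate D t | P x]| = count (fun s => P (s + t)) D.
Proof.
move=> uD; rewrite -size_filter -(card_uniqP (filter_uniq _ uD)).
rewrite -(card_imset _ (addIr (- t))); apply: eq_card => s.
rewrite mem_filter; apply/imsetP/andP.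
  by case=> x; rewrite !inE => /andP[Dx Px] ->; rewrite subrK.
by case=> Ps Ds; exists (s + t); rewrite ?inE addrK ?Ds.
Qed.

(** The translate of [D] by [t] contains [x] and [y] iff [s = x - t] and [s + (y - x)] lie in [D];
    so [t |-> x - t] matches the translates through both points with the occurrences of the
    difference [y - x]. *)
Lemma count_develop (V : finZmodType) (Ds : seq (seq V)) (x y : V) :
  all uniq Ds ->
  count (fun b : {set V} => (x \in b) && (y \in b)) (develop Ds) =
  difference_count Ds (y - x).
Proof.
rewrite /develop /difference_count.
elim: Ds => //= D Ds IH /andP[uD /IH{}IH].
rewrite count_cat IH; congr (_ + _)%N.
rewrite count_map -!size_filter -!(card_uniqP (filter_uniq _ _)) ?enum_uniq //.
have injB : injective (fun t => x - t) by move=> s t /addrI/oppr_inj.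
rewrite -(card_imset _ injB); apply: eq_card => s.
rewrite mem_filter; apply/imsetP/andP => [[t]|[ysD sD]].
  rewrite mem_filter /= !inE => /andP[/andP[xtD ytD] _] ->.
  by rewrite addrC addrA subrK.
exists (x - s); last by rewrite subKr.
by rewrite mem_filter mem_enum /= !inE subKr sD opprB addrCA ysD.
Qed.

Local Notation Z30 := 'I_30.

(** Since 30 is even, reduction modulo 30 preserves parity. *)
Lemma odd_addZ30 (x y : Z30) : odd (x + y)%R = odd x (+) odd y.
Proof.
have odd_mod m : odd (m %% 30) = odd m.
  by rewrite {2}(divn_eq m 30) oddD oddM andbF.
by rewrite /= odd_mod oddD.
Qed.

Lemma odd_subZ30 (x y : Z30) : odd (x - y)%R = odd x (+) odd y.
Proof. by rewrite -[in RHS](subrK y x) (odd_addZ30 (x - y)) addbK. Qed.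

Definition parity_class (e : bool) : {set Z30} := [set x : Z30 | odd x == e].

Definition parity_classes : {set {set Z30}} := [set parity_class e | e : bool].

Lemma card_parity_class (e : bool) : #|parity_class e| = 15%N.
Proof.
rewrite /parity_class -sum1dep_card.
(* Over a range of naturals the sum can be evaluated directly. *)
rewrite -(big_mkord (fun i => odd i == e) (fun=> 1%N)).
by rewrite unlock; case: e.
Qed.

Lemma mem_parity_class (e : bool) (x : Z30) :
  (x \in parity_class e) = (odd x == e).
Proof. by rewrite inE. Qed.

Lemma parity_class_inj : injective parity_class.
Proof.
(* The residue 0 or 1 of parity [e] tells the two classes apart. *)
move=> e f /setP/(_ (inZp e)); rewrite !inE.
by case: e f => [] [].
Qed.

Lemma parity_classesP : partition parity_classes [set: Z30].
Proof.
apply/and3P; split.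
- apply/eqP/setP=> x; rewrite inE; apply/bigcupP.
  by exists (parity_class (odd x)); rewrite ?imset_f ?mem_parity_class.
- apply/trivIsetP=> _ _ /imsetP[e _ ->] /imsetP[f _ ->] ef.
  rewrite -setI_eq0; apply: contraNT ef => /set0Pn[x].
  by rewrite !inE => /andP[/eqP-> /eqP->].
- by apply/imsetP=> -[e _ e0]; have := card_parity_class e; rewrite -e0 cards0.
Qed.

(** Each block lists its two even residues first, then its four odd ones. *)
Definition base_blocks : seq (seq Z30) :=
  [seq [seq inZp k | k <- D] | D <-
     nseq 3 [:: 0; 6; 1; 7; 9; 21] ++ nseq 5 [:: 4; 6; 1; 17; 23; 27] ++
     nseq 2 [:: 0; 10; 1; 5; 7; 23] ++ nseq 2 [:: 0; 8; 1; 13; 15; 25] ++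
     nseq 3 [:: 0; 12; 1; 3; 11; 15]]%N.

Lemma uniq_base_blocks : all uniq base_blocks.
Proof. by vm_compute. Qed.

Lemma base_block_parities (D : seq Z30) :
  D \in base_blocks ->
  forall e : bool,
    count (fun s : Z30 => odd s == e) D = if e then 4%N else 2%N.
Proof.
have /allP/[apply] : all (fun D : seq Z30 =>
    (count (fun s : Z30 => odd s == true) D == 4)%N &&
    (count (fun s : Z30 => odd s == false) D == 2)%N) base_blocks.
  by vm_compute.
by case/andP=> /eqP oD /eqP eD [].
Qed.

(** The difference 0 occurs once for each point of each base block, hence 15 * 6 = 90 times. *)
Lemma difference_count_base_blocks (d : Z30) :
  difference_count base_blocks d =
  (if d == 0%R then 90 else if odd d then 16 else 15)%N.
Proof.
(* The 30 residues are run through as naturals, so that the check is a closed computation. *)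
have /allP/(_ d) : all (fun k => difference_count base_blocks (inZp k) ==
   if k == 0 then 90 else if odd k then 16 else 15)%N (iota 0 30).
  by vm_compute.
by rewrite mem_iota ltn_ord valZpK => /(_ isT)/eqP.
Qed.

(** An even translation keeps the two parity classes and an odd one swaps them, so [s + t] has
    parity [e] iff [s] has parity [e (+) odd t]. *)
Lemma card_block_parity (D : seq Z30) (t : Z30) (e : bool) :
  D \in base_blocks ->
  #|translate D t :&: parity_class e| = if e (+) odd t then 4%N else 2%N.
Proof.
move=> DB; have uD := allP uniq_base_blocks D DB.
transitivity #|[set x in translate D t | odd x == e]|.
  by apply: eq_card => x; rewrite !inE.
rewrite (card_translate t (fun x : Z30 => odd x == e) uD).
rewrite -(base_block_parities DB); apply: eq_count => s.
by rewrite odd_addZ30; case: (odd s) (odd t) e => [] [] [].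
Qed.

Local Close Scope ring_scope.

Theorem theorem5p8 :
  exists (X : finType) (P : {set {set X}}) (B : seq {set X}),
    is_GDD 15 2 6 15 16 P B /\ has_configuration 2 4 P B.
Proof.
have cntE (x y : Z30) := count_develop x y uniq_base_blocks.
exists Z30, parity_classes, (develop base_blocks); split; last first.
  move=> _ /allpairsP[[D t] [/= DB _ ->]].
  (* The two even points of [D] are moved to parity [odd t], the four odd ones to the other
     parity. *)
  exists (parity_class (odd t)), (parity_class (~~ odd t)).
  rewrite !imset_f ?(inj_eq parity_class_inj) ?card_block_parity //.
  by case: (odd t).
split; first exact: parity_classesP.
- by rewrite card_imset ?card_bool //; apply: parity_class_inj.
- by move=> _ /imsetP[e _ ->]; apply: card_parity_class.
- move=> _ /allpairsP[[D t] [/= DB _ ->]].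
  rewrite -(cardsID (parity_class (odd t))) card_block_parity // addbb.
  have -> : translate D t :\: parity_class (odd t) =
            translate D t :&: parity_class (~~ odd t).
    by apply/setP=> x; rewrite !inE andbC; case: (odd x) (odd t) => [] [].
  by rewrite card_block_parity //; case: (odd t).
(* Blocks through [x] are blocks through the pair [x], [x], counted by the difference 0. *)
- exists 90 => x; have := cntE x x.
  rewrite subrr difference_count_base_blocks eqxx => <-.
  by apply: eq_count => b; rewrite andbb.
- move=> _ x y /imsetP[e _ ->]; rewrite !inE => /eqP xe /eqP ye xy.
  rewrite cntE difference_count_base_blocks subr_eq0 eq_sym (negPf xy).
  by rewrite odd_subZ30 xe ye addbb.
- move=> _ _ x y /imsetP[e _ ->] /imsetP[f _ ->].
  rewrite (inj_eq parity_class_inj) !inE => ef /eqP xe /eqP ye.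
  rewrite cntE difference_count_base_blocks odd_subZ30 xe ye subr_eq0.
  (* Points of different parity are distinct, which excludes the value 90; their difference is
     odd. *)
  have -> : (y == x) = false by apply: contraNF ef => /eqP yx; rewrite -xe -ye yx.
  by case: e f ef {xe ye} => [] [].
Qed.
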